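(* There exists a universal constant $c>0$ such that for every integer $k\ge 2$ and every $P_k$-free tournament $T$ on $n\ge 1$ vertices, the dichromatic number of $T$ satisfies $$\chi_a(T)\le n^{1-\frac{c}{k(\log k)^2}}.$$
   Context: All graphs are finite and simple. A tournament is a directed graph in which for every two distinct vertices $u,v$ exactly one of $(u,v),(v,u)$ is an edge. Logarithms are to base two. The directed path $P_k$ is the tournament with vertex set $\{v_1,\dots,v_k\}$ in which, for $1\le i<j\le k$, the edge between $v_i$ and $v_j$ is $(v_j,v_i)$ if $j=i+1$ and $(v_i,v_j)$ otherwise. A tournament is $P_k$-free if it has no induced subtournament isomorphic to $P_k$. An acyclic coloring of a digraph $D$ is a coloring of its vertices such that every color class induces an acyclic digraph; the dichromatic number $\chi_a(D)$ is the minimum number of colors in an acyclic coloring of $D$. *)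

(* Defs.v *)
From HB Require Import structures.
From mathcomp Require Import all_boot all_order all_algebra.
From mathcomp Require Import boolp reals exp.

Set Implicit Arguments.
Unset Strict Implicit.
Unset Printing Implicit Defensive.

Record digraph := Digraph {
  vertex :> finType;
  arc : rel vertex;
  arc_irr : irreflexive arc
}.

Record tournament := Tournament {
  tournament_digraph :> digraph;
  tournamentP : forall u v : tournament_digraph,
    u != v -> arc u v (+) arc v u
}.

Definition acyclic_on (D : digraph) (A : {set D}) : Prop :=
  forall p : seq D, {subset p <= A} -> ucycle (@arc D) p -> p = [::].

Definition acyclic_coloring (D : digraph) (m : nat) (f : {ffun D -> 'I_m}) :
    Prop :=
  forall i : 'I_m, acyclic_on [set x | f x == i].

Definition acyclic_colorable (D : digraph) (m : nat) : Prop :=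
  exists f : {ffun D -> 'I_m}, acyclic_coloring f.

Lemma acyclic_colorable_card (D : digraph) : acyclic_colorable D #|D|.
Proof.
exists [ffun x => enum_rank x] => i [//|x p] sub /andP[cyc un].
have E y : y \in x :: p -> y = enum_val i.
  by move/sub; rewrite inE ffunE => /eqP <-; rewrite enum_rankK.
case: p sub cyc un E => [|y p] _ /=; first by rewrite arc_irr.
move=> _ /andP[/negP xNyp _] E; case: xNyp.
by rewrite (E x (mem_head _ _)) -(E y) ?mem_head // inE mem_head orbT.
Qed.

Lemma ex_acyclic_colorable (D : digraph) :
  exists m, `[< acyclic_colorable D m >].
Proof. by exists #|D|; apply/asboolP/acyclic_colorable_card. Qed.

Definition dichromatic_number (D : digraph) : nat :=
  ex_minn (ex_acyclic_colorable D).

(* The vertex v_i of P_k is the ordinal of value i - 1. *)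
Definition dipath_arc (k : nat) : rel 'I_k :=
  fun i j => if (i < j)%N then (j : nat) != i.+1 else (i : nat) == j.+1.

Lemma dipath_arc_irr (k : nat) : irreflexive (@dipath_arc k).
Proof. by move=> i; rewrite /dipath_arc ltnn ltn_eqF. Qed.

Definition dipath_digraph (k : nat) : digraph := Digraph (@dipath_arc_irr k).

Lemma dipathP (k : nat) (u v : dipath_digraph k) :
  u != v -> arc u v (+) arc v u.
Proof.
rewrite -(inj_eq val_inj) /= /dipath_arc.
by case: (ltngtP u v) => //= _ _; [case: (val v == _)|case: (val u == _)].
Qed.

Definition dipath (k : nat) : tournament := Tournament (@dipathP k).

Definition induced_copy (H D : digraph) : Prop :=
  exists2 f : H -> D, injective f & forall u v : H, arc (f u) (f v) = arc u v.

Definition dipath_free (k : nat) (T : tournament) : Prop :=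
  ~ induced_copy (dipath k) T.

Definition log2 (R : realType) (x : R) : R := (ln x / ln 2)%R.

(* Main.v *)
Require Import Defs.
From HB Require Import structures.
From mathcomp Require Import all_boot all_order all_algebra.
From mathcomp Require Import boolp reals exp zify ring lra.
(* [arc] is also the name of a function of [mathcomp.path]. *)
Import Defs.

(** A shortest directed path on k vertices, read backwards, is an induced P_k.
    Let T be P_k-free and S a set of vertices.

    First, a path is grown inside S together with a pool X of candidates for its
    next vertex and a set C dominating the whole path. A vertex of X splitting C
    evenly prolongs the path, so the process ends, before k steps, with half of
    X almost complete to or from C. Iterating this log k times gives
    2^h >= k sets, each a fraction 2^(- O(k (log k)^2)) of S, with few arcs from
    earlier sets to later ones.

    Suppose S has no pair A, B of sets of about that size with all arcs going
    from A to B. Then every large set contains a large strongly connected set K,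
    and two large sets are joined by arcs in both directions. So a path can be
    led through these sets in turn: from its last vertex a shortest path runs
    through K into the next set, of which only the small part not dominating
    the path has been discarded. Each set contributes a vertex, so P_k appears.

    Hence a complete pair exists, with |S| <= 2^E min(|A|, |B|) for some
    E = O(k (log k)^2). Recursing in A and in B gives a transitive set of m
    vertices with |S| <= m^E, and removing transitive sets greedily colors T. *)

Set Implicit Arguments.
Unset Strict Implicit.
Unset Printing Implicit Defensive.

(** * Induced paths as vertex sequences *)

Section Tournament.
Variable T : tournament.
Implicit Types (x y z : T) (A B C D F G K P Q S W X : {set T}) (s t : seq T).

Lemma arcC x y : x != y -> arc y x = ~~ arc x y.
Proof. by move/tournamentP; case: (arc x y); case: (arc y x). Qed.

Lemma arc_asym x y : arc x y -> arc y x = false.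
Proof.
case: (eqVneq x y) => [->|/tournamentP]; first by rewrite arc_irr.
by case: (arc x y); case: (arc y x).
Qed.

(* All arcs between non-consecutive vertices point backwards: [s] is a shortest
   path, and [rev s] lists the vertices of a P_k in the order v_1, ..., v_k. *)
Fixpoint ipath s :=
  if s is x :: s' then
    (if s' is y :: s'' then arc x y && all (fun z => arc z x) s'' else true)
    && ipath s'
  else true.

Lemma ipath_arc x0 s i j : ipath s -> i < j < size s ->
  arc (nth x0 s i) (nth x0 s j) = (j == i.+1) /\
  arc (nth x0 s j) (nth x0 s i) = (j != i.+1).
Proof.
elim: s i j => [|x s IHs] i j; first by rewrite ltn0 andbF.
case: i j => [|i] [|j] //= /andP[xs ips] ij; last exact: IHs.
case: s xs ips ij {IHs} => [|y s] //= /andP[xy /allP xs] _.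
case: j => [|j] //=; first by rewrite xy arc_asym.
rewrite !ltnS => js; have h := xs _ (mem_nth x0 js).
by rewrite h arc_asym.
Qed.

Lemma ipath_copy k s : ipath s -> k <= size s -> induced_copy (dipath k) T.
Proof.
case: k => [|k] ips ks.
  by exists (fun i : 'I_0 => False_rect T (notF (ltn_ord i))) => [[]|[]].
have [x0 _] : exists x0, x0 \in s
  by case: s ks {ips} => // x s _; exists x; rewrite mem_head.
pose f (i : 'I_k.+1) := nth x0 s (k - i).
have fE u v : arc (f u) (f v) = dipath_arc u v.
  rewrite /f /dipath_arc; have ltu := ltn_ord u; have ltv := ltn_ord v.
  case: (ltngtP u v) => [uv|vu|->].
  - have /(ipath_arc x0 ips)[_ ->] : k - v < k - u < size s by lia.
    by congr (~~ _); lia.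
  - have /(ipath_arc x0 ips)[-> _] : k - u < k - v < size s by lia.
    by lia.
  by rewrite arc_irr; lia.
(* Distinct vertices of P_k are joined by an arc and [T] has no loops, so preserving arcs forces
   injectivity. *)
exists f => // u v fuv; apply/eqP/negPn/negP => /(@dipathP k.+1).
by rewrite /= -!fE fuv arc_irr.
Qed.

Lemma ipath_cat s c t :
  ipath (rcons s c) -> ipath (c :: t) ->
  (forall y z, y \in s -> z \in t -> arc z y) -> ipath (rcons s c ++ t).
Proof.
elim: s => [|a s IHs] //=; case/andP=> ha hs ht st.
have {}IHs : ipath (rcons s c ++ t).
  by apply: IHs => // y z ys; apply: st; rewrite inE ys orbT.
have at' : all (fun z => arc z a) t by apply/allP => z; apply: st; rewrite mem_head.
case: s ha hs IHs {st} => [|b s] /= ha _ ->.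
  by rewrite at' !andbT; case/andP: ha.
by rewrite all_cat at' !andbT.
Qed.

(** * Complete pairs and strongly connected sets *)

Definition complete A B := forall x y, x \in A -> y \in B -> arc x y.

(** Strong connectivity in terms of cuts: in a tournament its failure is at once a complete pair,
    from [K :\: Q] to [Q]. *)
Definition cut_connected K := forall Q, Q \subset K -> Q != set0 -> Q != K ->
  exists x y, [/\ x \in Q, y \in K :\: Q & arc x y].

Lemma complete_disjoint A B : complete A B -> [disjoint A & B].
Proof.
move=> AB; apply/pred0P => x /=; apply/negP => /andP[xA xB].
by have := AB x x xA xB; rewrite arc_irr.
Qed.

Lemma no_arc_complete A B : [disjoint A & B] ->
  (forall x y, x \in A -> y \in B -> ~~ arc x y) -> complete B A.
Proof.
move=> dAB nAB y x yB xA; have := nAB x y xA yB; rewrite -arcC //.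
by apply: contraTneq dAB => xy; apply/pred0Pn; exists x; rewrite /= xA xy.
Qed.

(* [F] and [G] are what has been split off the front and the back of a set whose
   remaining part is [K]; both stay smaller than [m]. *)
Lemma pair_or_connected_rec n m F K G S : 0 < m -> #|K| <= n ->
  complete F K -> complete F G -> complete K G ->
  #|F| < m -> #|G| < m -> 3 * m <= #|F| + #|K| + #|G| ->
  F \subset S -> K \subset S -> G \subset S ->
  (exists A B, [/\ A \subset S, B \subset S, complete A B, m <= #|A| & m <= #|B|])
  \/ (exists K', [/\ K' \subset K, cut_connected K' & m <= #|K'|]).
Proof.
elim: n F K G => [|n IHn] F K G m0 Kn FK FG KG Fm Gm FKG FS KS GS.
  by have : #|K| = 0 by [lia]; lia.
have [cK|ncK] := pselect (cut_connected K).
  (* Two ends smaller than [m] leave at least [m] of the [3 * m] vertices to [K]. *)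
  by right; exists K; split=> //; lia.
have [Q [QK Q0 QnK noQ]] : exists Q, [/\ Q \subset K, Q != set0, Q != K &
    forall x y, x \in Q -> y \in K :\: Q -> ~~ arc x y].
  apply: contrapT => nQ; apply: ncK => Q QK Q0 QnK; apply: contrapT => narc.
  apply: nQ; exists Q; split=> // x y xQ yQ; apply/negP => xy.
  by apply: narc; exists x, y.
set P := K :\: Q.
have PQ : complete P Q.
  by apply: no_arc_complete => //; rewrite -setI_eq0 /P setDE setICA setICr setI0.
have PK : P \subset K by apply: subsetDl.
have cKE : #|K| = #|Q| + #|P| by rewrite -(cardsID Q K) (setIidPr QK).
have Qpos : 0 < #|Q| by rewrite card_gt0.
have Ppos : 0 < #|P|.
  rewrite card_gt0; apply: contra QnK; rewrite setD_eq0 => KQ.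
  by rewrite eqEsubset QK.
have cU A B : complete A B -> #|A :|: B| = #|A| + #|B|.
  by move/complete_disjoint; rewrite -leq_card_setU => /eqP.
have FP : complete F P by move=> x y xF /(subsetP PK); apply: FK.
have FQ : complete F Q by move=> x y xF /(subsetP QK); apply: FK.
have PG : complete P G by move=> x y /(subsetP PK); apply: KG.
have QG : complete Q G by move=> x y /(subsetP QK); apply: KG.
have QS := subset_trans QK KS; have PS := subset_trans PK KS.
have cFP := cU _ _ FP; have cQG := cU _ _ QG.
have FPQ : complete (F :|: P) Q by move=> x y /setUP[]; [apply: FQ|apply: PQ].
have FPG : complete (F :|: P) G by move=> x y /setUP[]; [apply: FG|apply: PG].
have FQG : complete F (Q :|: G) by move=> x y xF /setUP[]; [apply: FQ|apply: FG].
have PQG : complete P (Q :|: G) by move=> x y xF /setUP[]; [apply: PQ|apply: PG].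
have FPS : F :|: P \subset S by rewrite subUset FS.
have QGS : Q :|: G \subset S by rewrite subUset QS.
have Qn : #|Q| <= n by rewrite -ltnS (leq_trans _ Kn) // cKE -addn1 leq_add2l.
have Pn : #|P| <= n by rewrite -ltnS (leq_trans _ Kn) // cKE -add1n leq_add2r.
(* The parts [F], [P], [Q], [G] are complete from left to right: a small front or back absorbs its
   neighbour, and two large ends form the pair. *)
have [FPm|FPm] := ltnP #|F :|: P| m.
  have sz : 3 * m <= #|F :|: P| + #|Q| + #|G|
    by rewrite cFP (addnAC #|F|) -(addnA #|F|) -cKE.
  have [?|[K' [K'Q ? ?]]] := IHn _ _ _ m0 Qn FPQ FPG QG FPm Gm sz FPS QS GS;
    first by left.
  by right; exists K'; split=> //; apply: subset_trans QK.
have [QGm|QGm] := ltnP #|Q :|: G| m.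
  have sz : 3 * m <= #|F| + #|P| + #|Q :|: G|
    by rewrite cQG addnA (addnAC #|F|) -(addnA #|F|) -cKE.
  have [?|[K' [K'Q ? ?]]] := IHn _ _ _ m0 Pn FP FQG PQG Fm QGm sz FS PS QGS;
    first by left.
  by right; exists K'; split=> //; apply: subset_trans PK.
left; exists (F :|: P), (Q :|: G); split=> //.
move=> x y /setUP[] xF /setUP[] yG; [exact: FQ|exact: FG|exact: PQ|exact: PG].
Qed.

Lemma pair_or_connected m D : 0 < m -> 3 * m <= #|D| ->
  (exists A B, [/\ A \subset D, B \subset D, complete A B, m <= #|A| & m <= #|B|])
  \/ (exists K, [/\ K \subset D, cut_connected K & m <= #|K|]).
Proof.
move=> m0 mD; apply: (@pair_or_connected_rec #|D| m set0 D set0 D);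
  rewrite ?cards0 ?sub0set ?addn0 //; by move=> x y; rewrite inE.
Qed.

(* The last hypothesis says that no cut separates [x] from [D] inside [C]. The
   induction is a breadth-first search from [D]: the vertices of [C] with an arc
   into [D] are the target of the recursive call. *)
Lemma connect_ipath n x C D : #|C| <= n -> x \notin C ->
  [disjoint C & D] -> (forall y, y \in D -> ~~ arc x y) ->
  (forall Q, Q \subset C -> (forall y, y \in C -> arc x y -> y \in Q) ->
    exists u v, [/\ u \in Q, v \in D :|: (C :\: Q) & arc u v]) ->
  exists p c, [/\ ipath (x :: rcons p c), {subset rcons p c <= C},
    (exists2 d, d \in D & arc c d) &
    forall y d, y \in p -> d \in D -> ~~ arc y d].
Proof.
elim: n C D => [|n IHn] C D Cn xC dCD xD reach.
  have C0 : C = set0 by apply/eqP; rewrite -cards_eq0 -leqn0.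
  by have [//||u [v [/=]]] := reach C; rewrite ?C0 //= inE.
pose L := [set c in C | [exists d in D, arc c d]].
have LC : L \subset C by apply/subsetP => c; rewrite inE => /andP[].
have [/existsP[c /andP[cL xc]]|noL] := boolP [exists c in L, arc x c].
  exists [::], c; split=> //=; first by rewrite xc.
    by move=> y; rewrite inE => /eqP ->; apply: (subsetP LC).
  by move: cL; rewrite inE => /andP[_ /existsP[d /andP[dD cd]]]; exists d.
have noxL c : c \in L -> ~~ arc x c.
  by move=> cL; apply: contra noL => xc; apply/existsP; exists c; rewrite cL.
have inL u v : u \in C -> v \in D -> arc u v -> u \in L.
  by move=> uC vD uv; rewrite inE uC; apply/existsP; exists v; rewrite vD.
have [l lL] : exists l, l \in L.
  have [//|//|u [v [uC]]] := reach C; rewrite setDv setU0 => vD uv.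
  by exists u; apply: inL uv.
have [||||Q QC Qx|p [c [ipc pcC [d dL cd] pL]]] := IHn (C :\: L) L.
- have : 0 < #|L| by rewrite card_gt0; apply/set0Pn; exists l.
  by rewrite cardsD (setIidPr LC); lia.
- by rewrite inE (negbTE xC) andbF.
- by rewrite -setI_eq0 setIC setDE setICA setICr setI0.
- exact: noxL.
- have QC' : Q \subset C by apply: subset_trans QC (subsetDl _ _).
  have QL u : u \in Q -> u \in L = false.
    by move/(subsetP QC); rewrite inE => /andP[/negbTE].
  have [//|y yC xy|u [v [uQ vDC uv]]] := reach Q.
    by apply: Qx => //; rewrite inE yC andbT; apply/negP => /noxL; rewrite xy.
  (* An arc from [Q] into [D] would put its tail in [L], which [Q] avoids; so the cut condition
     passes to the target [L]. *)
  exists u, v; split=> //; move: vDC; rewrite !inE.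
  case/orP => [vD|/andP[vQ vC]]; last by rewrite vC vQ !andbT; case: [exists _ in _, _].
  by have := QL u uQ; rewrite (inL u v) // (subsetP QC').
have pcL y : y \in rcons p c -> y \in C /\ y \notin L.
  by move/pcC; rewrite inE => /andP[].
exists (rcons p c), d; split.
- rewrite -rcons_cons -cats1 -rcons_cons; apply: ipath_cat => //=; first by rewrite cd.
  move=> y z yp; rewrite inE => /eqP ->.
  have yd : y != d.
    move: yp; rewrite inE => /orP[/eqP->|yp].
      by apply: contra xC => /eqP ->; apply: (subsetP LC).
    have [|_] := pcL y; first by rewrite mem_rcons inE yp orbT.
    by apply: contraNneq => ->.
  rewrite (arcC yd); move: yp; rewrite inE => /orP[/eqP->|yp]; first exact: noxL.
  exact: pL.
- move=> y; rewrite mem_rcons inE => /orP[/eqP->|/pcL[]//]; exact: (subsetP LC).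
- by move: dL; rewrite inE => /andP[_ /existsP[e /andP[eD de]]]; exists e.
- move=> y e /pcL[yC yL] eD; apply: contra yL => ye; exact: inL ye.
Qed.

(** * Sparse directions and nearly transitive pieces *)

Definition nbr (b : bool) x := [set y | if b then arc x y else arc y x].
(** The bit [b] is an orientation, so that sets almost complete to [C] and almost complete from [C]
    share one argument. *)
Definition arcs b A B := \sum_(x in A) #|nbr b x :&: B|.

Lemma arcsC b A B : arcs b A B = arcs (~~ b) B A.
Proof.
have E c X Y : arcs c X Y =
    \sum_(x in X) \sum_(y in Y) nat_of_bool (if c then arc x y else arc y x).
  apply: eq_bigr => x _; rewrite -sum1_card big_mkcond [RHS]big_mkcond /=.
  by apply: eq_bigr => y _; rewrite !inE;
    case: (y \in Y); rewrite ?andbT ?andbF; case: c => /=; do ?case: arc.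
by rewrite !E exchange_big; case: b.
Qed.

(** Markov's inequality and a union bound: for each [A], at most a fraction [r / q] of [C] has more
    than a fraction [1 / r] of [A] as bad neighbours, so all of [s] spoils at most half of [C]. *)
Lemma filter_few b r q C (s : seq {set T}) : 0 < q -> 2 * size s * r <= q ->
  (forall A, A \in s -> q * arcs b A C <= #|A| * #|C|) ->
  #|C| <= 2 * #|[set c in C | all (fun A => r * #|nbr (~~ b) c :&: A| <= #|A|) s]|.
Proof.
move=> q0 sq few; set C' := [set c in C | _].
have C'C : C' \subset C by apply/subsetP => c; rewrite inE => /andP[].
have cC : #|C| = #|C'| + #|C :\: C'| by rewrite -(cardsID C' C) (setIidPr C'C).
suff : q * #|C :\: C'| <= size s * r * #|C|.
  move: sq => /(leq_mul (leqnn #|C|)) sq le.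
  have : q * (2 * #|C :\: C'|) <= q * #|C| by lia.
  by rewrite leq_pmul2l //; lia.
rewrite {C'C cC sq}/C'; elim: s few => [|A s IHs] few /=.
  set X := _ :\: _; suff -> : X = set0 by rewrite cards0 muln0.
  by apply/setP=> c; rewrite !inE andbT andNb.
pose Bd := [set c in C | #|A| < r * #|nbr (~~ b) c :&: A|].
have bad : q * #|Bd| <= r * #|C|.
  have [A0|Apos] := posnP #|A|.
    suff -> : Bd = set0 by rewrite cards0 muln0.
    apply/setP => c; rewrite !inE A0; apply/negbTE; rewrite negb_and orbC -leqNgt.
    by rewrite (_ : #|_| = 0) ?muln0 //; apply/eqP;
      rewrite -leqn0 -A0 subset_leq_card // subsetIr.
  rewrite -(leq_pmul2l Apos).
  have : #|A| * #|Bd| <= r * arcs (~~ b) C A.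
    rewrite -[#|Bd|]sum1_card big_distrr /arcs big_distrr /= [leqRHS](bigID (mem Bd)) /=.
    apply: leq_trans (leq_addr _ _).
    rewrite [leqRHS](eq_bigl (mem Bd)) => [|c]; last by rewrite !inE andbA andbb.
    by apply: leq_sum => c; rewrite inE muln1 => /andP[_ /ltnW].
  rewrite -arcsC; have := few A (mem_head _ _); move: (arcs _ _ _) => e.
  move=> /(leq_mul (leqnn r)) h1 /(leq_mul (leqnn q)) h2; lia.
have {}IHs := IHs (fun B Bs => few B (mem_behead (s := A :: s) Bs)).
set C1 := [set c in C | _] in IHs *.
have sub : C :\: [set c in C | (r * #|nbr (~~ b) c :&: A| <= #|A|)
    && all (fun A0 => r * #|nbr (~~ b) c :&: A0| <= #|A0|) s] \subset Bd :|: (C :\: C1).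
  apply/subsetP => c; rewrite !inE; case: (c \in C) => //=; rewrite ?andbT ?andbF //.
  by rewrite negb_and -ltnNge.
have := subset_leq_card sub; have := leq_card_setU Bd (C :\: C1) => -[+ _].
move=> h1 h2; have := leq_mul (leqnn q) (leq_trans h2 h1); lia.
Qed.

Lemma arcs_few b r A B : (forall x, x \in A -> r * #|nbr b x :&: B| <= #|B|) ->
  r * arcs b A B <= #|A| * #|B|.
Proof.
move=> few; rewrite /arcs big_distrr /= -sum_nat_const.
by apply: leq_sum => x /few.
Qed.

(* A vertex of [X] with many out- and in-neighbours in [C] starts the path, and
   these neighbours replace [X] and [C] in the recursive call. *)
Lemma ipath_or_few q N j : forall a X C, 0 < q -> 0 < N ->
  N <= q ^ a * #|X| -> N <= q ^ a * #|C| -> [disjoint X & C] ->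
  (exists x s, [/\ ipath (x :: s), x \in X, {subset s <= C} & size s = j])
  \/ (exists b X' C', [/\ X' \subset X :|: C, C' \subset C, [disjoint X' & C'],
        N <= 2 * q ^ (a + j) * #|X'| /\ N <= q ^ (a + j) * #|C'| &
        forall x, x \in X' -> q * #|nbr b x :&: C'| <= #|C'|]).
Proof.
elim: j => [|j IHj] a X C q0 N0 NX NC dXC.
  left; have : 0 < #|X| by move: NX; case: #|X| => //; rewrite muln0; lia.
  by rewrite card_gt0 => /set0Pn[x xX]; exists x, [::].
have qle : q ^ a <= q ^ (a + j.+1) by rewrite expnD leq_pmulr // expn_gt0 q0.
have [/existsP[x /andP[xX /andP[xo xi]]]|nsplit] := boolP [exists x in X,
    (#|C| <= q * #|nbr true x :&: C|) && (#|C| <= q * #|nbr false x :&: C|)].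
  have le b : #|C| <= q * #|nbr b x :&: C| -> N <= q ^ a.+1 * #|nbr b x :&: C|.
    by move=> h; rewrite expnSr -mulnA (leq_trans NC) // leq_mul2l h orbT.
  have dio : [disjoint nbr true x :&: C & nbr false x :&: C].
    rewrite -setI_eq0; apply/eqP/setP => y; rewrite !inE.
    by case xy: (arc x y); rewrite ?(arc_asym xy) ?andbF.
  have [[y [s [ys yX sC <-]]]|[b [X' [C' [X'C C'C dX'C sz few]]]]] :=
      IHj _ _ _ q0 N0 (le _ xo) (le _ xi) dio.
    left; exists x, (y :: s); split=> //=.
    - move: yX; rewrite !inE => /andP[-> _] /=; rewrite -/(ipath (y :: s)) ys andbT.
      by apply/allP => z /sC; rewrite !inE => /andP[].
    - have yC : y \in C by move: yX; rewrite inE => /andP[].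
      by move=> z; rewrite inE => /orP[/eqP->//|/sC]; rewrite inE => /andP[].
  right; exists b, X', C'; rewrite -addSnnS; split=> //.
    apply: subset_trans X'C _; rewrite subUset; apply/andP; split;
      by apply: subset_trans (subsetIr _ _) (subsetUr _ _).
  exact: subset_trans C'C (subsetIr _ _).
(* Without a splitting vertex, every vertex of [X] is sparse to [C] in some direction, and at least
   half of them share one. *)
right; pose Xb b := [set x in X | q * #|nbr b x :&: C| <= #|C|].
have XU : X \subset Xb true :|: Xb false.
  apply/subsetP => x xX; rewrite !inE xX /=; apply: contraR nsplit.
  rewrite negb_or -!ltnNge => /andP[xo xi]; apply/existsP; exists x.
  by rewrite xX (ltnW xo) (ltnW xi).
have [b Xle] : exists b, #|X| <= 2 * #|Xb b|.
  have h := leq_trans (subset_leq_card XU) (leq_card_setU _ _).1.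
  have [le|le] := leqP #|Xb false| #|Xb true|; [exists true|exists false];
    by apply: leq_trans h _; rewrite mul2n -addnn ?leq_add2l ?leq_add2r // ltnW.
have XbX : Xb b \subset X by apply/subsetP => x; rewrite inE => /andP[].
exists b, (Xb b), C; split=> //.
- exact: subset_trans XbX (subsetUl _ _).
- exact: disjointWl XbX dXC.
- split; last by apply: leq_trans NC (leq_mul qle (leqnn _)).
  rewrite mulnAC mulnC; exact: leq_trans NX (leq_mul qle Xle).
by move=> x; rewrite inE => /andP[].
Qed.

Lemma split_half S : 2 <= #|S| -> exists X C,
  [/\ X \subset S, C \subset S, [disjoint X & C] & #|S| <= 4 * #|X| /\ #|S| <= 4 * #|C|].
Proof.
move=> S2; have [X [XS Xc]] : exists X, X \subset S /\ #|X| = #|S| %/ 2.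
  have /card_geqP[s [us <- sS]] : #|S| %/ 2 <= #|S| by apply: leq_div.
  exists [set x in s]; split; first by apply/subsetP => x; rewrite inE => /sS.
  by rewrite cardsE; apply/card_uniqP.
exists X, (S :\: X); split=> //; first exact: subsetDl.
  by rewrite -setI_eq0 setDE setICA setICr setI0.
by rewrite cardsD (setIidPr XS) Xc; lia.
Qed.

(** In a list that is pairwise [few_arcs r], later pieces almost dominate earlier ones, like the
    non-consecutive vertices of an [ipath]. *)
Definition few_arcs r A B := [disjoint A & B] && (r * arcs true A B <= #|A| * #|B|).

(** The sparse direction decides the order: the pieces of [X] come first when arcs from [X] to [C]
    are few, and last otherwise. *)
Lemma few_arcs_pieces b r X C (u v : seq {set T}) : [disjoint X & C] ->
  {in u, forall A, A \subset X} -> {in v, forall B, B \subset C} ->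
  {in u & C, forall A c, r * #|nbr (~~ b) c :&: A| <= #|A|} ->
  pairwise (few_arcs r) u -> pairwise (few_arcs r) v ->
  pairwise (few_arcs r) (if b then u ++ v else v ++ u).
Proof.
move=> dXC uX vC few pu pv.
have sz A B : A \in u -> B \in v -> r * arcs (~~ b) B A <= #|B| * #|A|.
  by move=> Au Bv; apply: arcs_few => c cB; apply: few => //; apply: (subsetP (vC _ Bv)).
have dAB A B : A \in u -> B \in v -> [disjoint A & B].
  by move=> Au Bv; apply: disjointW dXC; [apply: uX|apply: vC].
case: b few sz => few sz; rewrite pairwise_cat pu pv !andbT; apply/allrelP => A B Au Bv.
  by rewrite /few_arcs dAB //= arcsC mulnC [leqRHS]mulnC mulnC sz.
by rewrite /few_arcs disjoint_sym dAB //= sz.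
Qed.

(* The pieces of [X] are chosen first; the vertices of [C] with many bad arcs to
   one of them are then discarded before [C] is cut in turn, so that smallness
   of the number of arcs passes to the pieces. *)
Lemma near_transitive_pieces k r q H : 0 < k ->
  (forall s, ipath s -> size s < k) -> 4 <= q -> 2 * 2 ^ H * r <= q ->
  forall h S, h <= H -> (4 * q ^ k) ^ h <= #|S| ->
  exists u : seq {set T}, [/\ size u = 2 ^ h, pairwise (few_arcs r) u &
    {in u, forall A, A \subset S /\ #|S| <= (4 * q ^ k) ^ h * #|A|}].
Proof.
move=> k0 free q4 qH; set c := 4 * q ^ k.
have q0 : 0 < q by apply: leq_trans q4.
have qk0 : 0 < q ^ k by rewrite expn_gt0 q0.
elim=> [|h IHh] S hH cS.
  by exists [:: S]; split=> // A; rewrite inE => /eqP ->; rewrite expn0 mul1n.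
have ch0 : 0 < c ^ h by rewrite expn_gt0 muln_gt0 qk0.
have S2 : 2 <= #|S|.
  by apply: leq_trans cS; rewrite expnS;
    apply: (@leq_trans c); [rewrite /c; lia|rewrite leq_pmulr].
have [X0 [C0 [X0S C0S d0 [X0c C0c]]]] := split_half S2.
(* As [4 <= q], halving costs at most one factor [q]: the search starts at [a = 1], and its [k.-1]
   steps raise the exponent to [k]. *)
have le4 D : #|S| <= 4 * #|D| -> #|S| <= q ^ 1 * #|D|.
  by move=> h1; apply: leq_trans h1 _; rewrite leq_mul2r q4 orbT.
have [[x [s [ips _ _ ss]]]|[b [X [C [XS CS dXC [SX SC] few]]]]] :=
    ipath_or_few k.-1 q0 (ltnW S2) (le4 _ X0c) (le4 _ C0c) d0.
  by have := free _ ips; rewrite /= ss prednK // ltnn.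
move: SX SC; rewrite add1n prednK // => SX SC.
have {}XS : X \subset S by apply: subset_trans XS _; rewrite subUset X0S.
have {}CS : C \subset S by apply: subset_trans C0S.
have big D : #|S| <= c * #|D| -> c ^ h <= #|D|.
  by move=> le; rewrite -(leq_pmul2l (m := c)) ?muln_gt0 ?qk0 // -expnS (leq_trans cS).
have SX' : #|S| <= c * #|X|.
  by apply: leq_trans SX _; rewrite leq_mul2r leq_mul2r orbT orbT.
have [u [su pu uX]] := IHh X (ltnW hH) (big _ SX').
pose C' := [set c in C | all (fun A => r * #|nbr (~~ b) c :&: A| <= #|A|) u].
have CC' : #|C| <= 2 * #|C'|.
  apply: (filter_few q0); first by rewrite su (leq_trans _ qH) //
    leq_mul2r leq_mul2l leq_exp2l ?(ltnW hH) ?orbT.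
  move=> A Au; apply: arcs_few => x xA; apply: few; exact: (subsetP (uX A Au).1).
have C'C : C' \subset C by apply/subsetP => x; rewrite inE => /andP[].
have SC' : #|S| <= c * #|C'|.
  by apply: leq_trans SC _; rewrite /c [4 * _]mulnC -mulnA leq_mul2l
    (leq_trans CC') ?orbT // leq_mul2r orbT.
have [v [sv pv vC]] := IHh C' (ltnW hH) (big _ SC').
exists (if b then u ++ v else v ++ u); split.
- by case: b {few C' CC' C'C SC' vC}; rewrite size_cat su sv expnS mul2n addnn.
- apply: (@few_arcs_pieces b r X C').
  + exact: disjointWr C'C dXC.
  + by move=> A /uX[].
  + by move=> A /vC[].
  + by move=> A y Au; rewrite inE => /andP[_ /allP]; apply.
  + by [].
  + by [].
have piece D A : #|S| <= c * #|D| -> D \subset S -> A \subset D /\ #|D| <= c ^ h * #|A| ->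
    A \subset S /\ #|S| <= c ^ h.+1 * #|A|.
  move=> SD DS [AD DA]; split; first exact: subset_trans DS.
  by apply: leq_trans SD _; rewrite expnS -mulnA leq_mul2l DA orbT.
have C'S := subset_trans C'C CS.
move=> A Auv; have : A \in u ++ v by case: (b) Auv; rewrite !mem_cat // orbC.
by rewrite mem_cat => /orP[/uX|/vC]; apply: piece.
Qed.

(** * Leading an induced path through the pieces *)

(** Each [y] in [s] dominates at most a fraction [1 / q] of [B], and the other vertices of [B]
    dominate [y]. *)
Lemma card_filter_arcs q i B W s : q * #|B :\: W| <= i * #|B| ->
  {in s, forall y, y \notin B /\ q * #|nbr true y :&: B| <= #|B|} ->
  q * #|B :\: [set w in W | all (arc w) s]| <= (i + size s) * #|B|.
Proof.
move=> hW; elim: s => [|y s IHs] hs.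
  rewrite addn0 (_ : [set _ in _ | _] = W) //.
  by apply/setP => w; rewrite !inE andbT.
have [yB fy] := hs y (mem_head _ _).
have {}IHs := IHs (fun z zs => hs z (mem_behead (s := y :: s) zs)).
set W1 := [set w in W | all (arc w) s] in IHs.
have sub : B :\: [set w in W | all (arc w) (y :: s)]
    \subset (nbr true y :&: B) :|: (B :\: W1).
  apply/subsetP => z; rewrite !inE /= => /andP[nz zB]; rewrite zB !andbT.
  have zy : z != y by apply: contraNneq yB => <-.
  by move: nz; case: (z \in W) => /=; rewrite ?orbT // negb_and (arcC zy).
have h := leq_trans (subset_leq_card sub) (leq_card_setU _ _).1.
apply: leq_trans (leq_mul (leqnn q) h) _.
by rewrite mulnDr addnS addnC mulSn addnC leq_add.
Qed.

(** The size condition of [filter_few] for [n] sets, with [r = 4 * M] and [q = 8 * M ^ 2]. *)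
Lemma leq_mul_sqr n M : n <= M -> 2 * n * (4 * M) <= 8 * M ^ 2.
Proof. by move=> nM; rewrite -mulnn mulnACA [2 * 4]/= leq_mul2l leq_mul2r nM orbT. Qed.

(* [i] vertices have been visited before [x]; [W] consists of vertices dominating
   all of them, and [C] is the set from which the path is to continue. *)
Lemma grow_ipath M m S : 0 < m ->
  (forall A B, A \subset S -> B \subset S -> complete A B ->
    m <= #|A| -> m <= #|B| -> False) ->
  forall (u : seq {set T}) i x C W, i < M -> size u <= M ->
  pairwise (few_arcs (8 * M ^ 2)) u ->
  {in u, forall A, [/\ A \subset S, 12 * m <= #|A|, [disjoint C & A], x \notin A &
     4 * M * #|A :\: W| <= i * #|A|]} ->
  {in u, forall A, forall y, y = x \/ y \in C -> 4 * M * #|nbr true y :&: A| <= #|A|} ->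
  x \notin C -> C \subset S -> C \subset W -> cut_connected C -> m <= #|C| ->
  (exists2 y, y \in C & arc x y) ->
  exists t, [/\ ipath (x :: t), {subset t <= W} & minn (size u).+1 (M - i) <= size t].
Proof.
move=> m0 nopair; elim=> [|A u IHu] i x C W iM uM pu hA hC xC CS CW cC mC [y yC xy].
  exists [:: y]; split=> /=; rewrite ?xy // ?geq_minl // => z.
  by rewrite inE => /eqP ->; apply: (subsetP CW).
have M0 : 0 < M by apply: leq_ltn_trans iM.
have [AS mA dCA xA AW] := hA A (mem_head _ _).
have hu B : B \in u -> B \in A :: u by move=> Bu; rewrite inE Bu orbT.
move: (pu) => /=/andP[/allP fewA pu'].
pose A' := [set a in A | all (fun B => 4 * M * #|nbr (~~ false) a :&: B| <= #|B|) u].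
have A'A : A' \subset A by apply/subsetP => a; rewrite inE => /andP[].
have AA' : #|A| <= 2 * #|A'|.
  apply: (@filter_few false (4 * M) (8 * M ^ 2)).
  - by rewrite muln_gt0 expn_gt0 M0.
  - exact: leq_mul_sqr (ltnW uM).
  - by move=> B /fewA/andP[_]; rewrite arcsC [leqRHS]mulnC.
pose W1 := [set w in W | all (arc w) [:: x]].
have AW1 : 4 * M * #|A :\: W1| <= (i + 1) * #|A|.
  apply: card_filter_arcs => // z; rewrite inE => /eqP ->; split=> //.
  by apply: hC; [rewrite mem_head|left].
(* [A'] is at least half of [A], and [W1] misses at most a quarter of [A] because [i + 1 <= M]; a
   quarter of [12 * m] remains. *)
have DD : 3 * m <= #|A' :&: W1|.
  have h1 : 4 * #|A :\: W1| <= #|A|.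
    rewrite -(leq_pmul2l M0) mulnCA mulnA (leq_trans AW1) // leq_mul2r.
    by rewrite addn1 iM orbT.
  have h2 : #|A' :\: W1| <= #|A :\: W1| by rewrite subset_leq_card // setSD.
  have h3 := cardsID W1 A'.
  move: mA AA' h1 h2 h3; clear; move: #|A| #|A'| #|A :\: _| #|A' :\: _| #|_ :&: _|; lia.
have [[P [Q [PD QD PQ mP mQ]]]|[K [KD cK mK]]] := pair_or_connected m0 DD.
  have DS : A' :&: W1 \subset S
    by rewrite (subset_trans (subsetIl _ _)) // (subset_trans A'A).
  by case: (nopair P Q) => //; apply: subset_trans DS.
have KA' := subset_trans KD (subsetIl _ _); have KA := subset_trans KA' A'A.
have KS := subset_trans KA AS.
have KW1 w : w \in K -> w \in W /\ arc w x.
  by move/(subsetP KD); rewrite !inE /= andbT => /andP[_ /andP[]].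
have dCK : [disjoint C & K] by apply: disjointWr dCA.
have [u0 [v0 [u0C v0K uv0]]] : exists u0 v0, [/\ u0 \in C, v0 \in K & arc u0 v0].
  apply: contrapT => narc; apply: (nopair K C) => //;
    apply: no_arc_complete => // a b aC bK.
  by apply/negP => ab; apply: narc; exists a, b.
have [||p [c [ipc pcC [d dK cd] pK]]] := @connect_ipath #|C| x C K (leqnn _) xC dCK.
- by move=> w /KW1[_ wx]; rewrite arc_asym.
(* The cut [Q = C] is crossed by the arc into [K], any smaller one by strong connectivity of [C]. *)
- move=> Q QC Qx; have yQ := Qx y yC xy.
  have [->|QnC] := eqVneq Q C; first by exists u0, v0; rewrite setDv setU0.
  have [|//|a [b [aQ bC ab]]] := cC Q QC; first by apply/set0Pn; exists y.
  by exists a, b; split=> //; rewrite in_setU bC orbT.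
have cC' : c \in C by apply: pcC; rewrite mem_rcons mem_head.
have pC z : z \in p -> z \in C by move=> zp; apply: pcC; rewrite mem_rcons inE zp orbT.
have pcW : {subset rcons p c <= W} by move=> z /pcC/(subsetP CW).
have [le|lt] := leqP (M - i) (size (rcons p c)).
  by exists (rcons p c); split=> //; apply: leq_trans (geq_minr _ _) le.
have notin D z : [disjoint C & D] -> z \in C -> z \notin D.
  by move=> dCD zC; rewrite (disjointFr dCD).
(* The endpoint [c] becomes the current vertex. It is not among those that [W'] must dominate, as it
   has an arc into [K]. *)
pose W' := [set w in W | all (arc w) (x :: p)].
have [|||B Bu|B Bu z zcK|||||||t [ipt tW' st]] := IHu (i + size (rcons p c)) c K W'.
- by move: lt; rewrite ltn_subRL.
- exact: ltnW.
- by [].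
- have [BS mB dCB xB BW] := hA B (hu B Bu); split=> //.
  + have /andP[dAB _] := fewA B Bu; exact: disjointWl dAB.
  + exact: notin.
  + rewrite size_rcons -/(size (x :: p)); apply: card_filter_arcs => // z zp.
    have {}zp : z = x \/ z \in C by move: zp; rewrite inE => /orP[/eqP|/pC]; [left|right].
    by split; [case: zp => [->//|]; apply: notin|apply: hC => //; apply: hu].
- case: zcK => [->|zK]; first by apply: hC; [apply: hu|right].
  by move: (subsetP KA' z zK); rewrite inE => /andP[_ /allP/(_ B Bu)].
- exact: notin.
- exact: KS.
- apply/subsetP => w wK; have [wW wx] := KW1 w wK; rewrite inE wW /= wx /=.
  apply/allP => z zp; have zC := pC z zp.
  by rewrite arcC ?pK //; apply: contraTneq wK => <-; apply: notin.
- exact: cK.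
- exact: mK.
- by exists d.
exists (rcons p c ++ t); split.
- apply: (@ipath_cat (x :: p) c t) => // a b aP /tW'.
  by rewrite inE => /andP[_ /allP/(_ a aP)].
- by move=> z; rewrite mem_cat => /orP[/pcW //|/tW']; rewrite inE => /andP[].
rewrite size_cat; move: st lt; rewrite size_rcons /=; clear.
move: (size t) (size p) (size u); lia.
Qed.

(** * From complete pairs to transitive sets *)

Lemma pure_pair k h E : 1 < k <= 2 ^ h ->
  (forall s, ipath s -> size s < k) ->
  32 * (4 * (16 * (2 ^ h) ^ 3) ^ k) ^ h <= 2 ^ E ->
  forall S, 2 <= #|S| -> exists A B, [/\ A \subset S, B \subset S, complete A B,
    #|S| <= 2 ^ E * #|A| & #|S| <= 2 ^ E * #|B|].
Proof.
move=> /andP[k1 kM] free; set M := 2 ^ h in kM *; set c := _ ^ h => cE S S2.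
have E0 : 0 < 2 ^ E by rewrite expn_gt0.
(* For small [S] the two ends of a single arc suffice. *)
have [small|large] := leqP #|S| (2 ^ E).
  have /card_gt1P[x [y [xS yS xy]]] := S2.
  wlog xyT : x y xS yS xy / arc x y.
    move=> hw; have [|] := boolP (arc x y); first exact: hw.
    by rewrite -arcC //; apply: hw => //; rewrite eq_sym.
  exists [set x], [set y]; rewrite !cards1 !sub1set muln1; split=> //.
  by move=> a b; rewrite !inE => /eqP-> /eqP->.
apply: contrapT => npair.
pose m := (#|S| %/ 2 ^ E).+1.
have Sm : #|S| <= 2 ^ E * m by rewrite mulnC ltnW // ltn_ceil.
(* The quotient is positive, so [m] is at most twice it; the resulting factor 24 is covered by the
   32. *)
have mS : c * (12 * m) <= #|S|.
  have h1 : m <= 2 * (#|S| %/ 2 ^ E)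
    by rewrite /m mul2n -addnn -addn1 leq_add2l divn_gt0 // ltnW.
  have h2 := leq_divM #|S| (2 ^ E).
  have aux a b d e n : 32 * a <= e -> b <= 2 * d -> d * e <= n -> a * (12 * b) <= n.
    by move=> + /leq_mul le => /le {}le; clear -le; lia.
  exact: aux cE h1 h2.
have nopair A B : A \subset S -> B \subset S -> complete A B ->
    m <= #|A| -> m <= #|B| -> False.
  move=> AS BS AB mA mB; apply: npair; exists A, B; split=> //;
  by apply: leq_trans Sm _; rewrite leq_mul2l ?mA ?mB orbT.
have M1 : 1 < M by apply: leq_trans kM.
have M0 : 0 < M by apply: ltnW.
have [|||u [su pu hu]] :=
  @near_transitive_pieces k (8 * M ^ 2) (16 * M ^ 3) h (ltnW k1) free _ _ h S (leqnn _).
- by apply: (@leq_trans 16) => //; rewrite leq_pmulr // expn_gt0 M0.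
- by rewrite -/M [M ^ 3]expnS mulnACA.
- by apply: leq_trans mS; rewrite leq_pmulr // muln_gt0.
have c0 : 0 < c by rewrite !(expn_gt0, muln_gt0).
have bigA A : A \in u -> A \subset S /\ 12 * m <= #|A|.
  by case/hu=> AS le; split=> //; rewrite -(leq_pmul2l c0) (leq_trans mS).
(* The first piece supplies the starting vertex and the second the first connected set; [M - 2]
   pieces are left. *)
case: u su pu bigA hu => [|A1 [|A2 u]] su pu bigA _;
  do ?by [move: su M1; rewrite /M => <-].
move: pu => /= /andP[/andP[few12 /allP few1] /andP[/allP few2 pu]].
have {}su : (size u).+2 = M by [].
pose cl A := [set a in A | all (fun B => 4 * M * #|nbr (~~ false) a :&: B| <= #|B|) u].
have clA A : {in u, forall B, few_arcs (8 * M ^ 2) A B} -> #|A| <= 2 * #|cl A|.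
  move=> fA; apply: (@filter_few false (4 * M) (8 * M ^ 2)).
  - by rewrite muln_gt0 expn_gt0 M0.
  - by apply: leq_mul_sqr; rewrite -su -addn2 leq_addr.
  - by move=> B /fA/andP[_]; rewrite arcsC [leqRHS]mulnC.
have clS A : cl A \subset A by apply/subsetP => a; rewrite inE => /andP[].
have [A1S mA1] := bigA A1 (mem_head _ _).
have [A2S mA2] : A2 \subset S /\ 12 * m <= #|A2| by apply: bigA; rewrite !inE eqxx orbT.
have mc1 : m <= #|cl A1| by have := clA A1 few1; move: mA1; lia.
have mc2 : 3 * m <= #|cl A2| by have := clA A2 few2; move: mA2; lia.
have [[P [Q [PD QD PQ mP mQ]]]|[K [KD cK mK]]] :=
  pair_or_connected (ltn0Sn _ : 0 < m) mc2.
  by apply: (nopair P Q) => //; apply: subset_trans A2S; apply: subset_trans (clS _).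
have KA2 := subset_trans KD (clS _).
have d12 : [disjoint A1 & A2] by case/andP: few12.
have d1K : [disjoint cl A1 & K] by apply: disjointW d12.
have [x [y [xA yK xy]]] : exists x y, [/\ x \in cl A1, y \in K & arc x y].
  apply: contrapT => narc; apply: (nopair K (cl A1)) => //.
  - exact: subset_trans A2S.
  - exact: subset_trans A1S.
  apply: no_arc_complete => // a b aC bK.
  by apply/negP => ab; apply: narc; exists a, b.
have [|||||||||t [ipt _ st]] :=
    @grow_ipath M m S (ltn0Sn _) nopair u 0 x K setT M0 _ pu.
- by rewrite -su -addn2 leq_addr.
- move=> B Bu; have [|BS mB] := bigA B; first by rewrite !inE Bu !orbT.
  split=> //; rewrite ?setDT ?cards0 ?muln0 //.
    by have /andP[d _] := few2 B Bu; apply: disjointWl d.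
  have /andP[d _] := few1 B Bu; rewrite (disjointFr d) //; exact: (subsetP (clS A1)).
- move=> B Bu z [->|zK]; [move: xA|move: (subsetP KD z zK)];
    by rewrite inE => /andP[_ /allP/(_ B Bu)].
- by rewrite (disjointFr d1K).
- exact: subset_trans A2S.
- exact: subsetT.
- by [].
- by [].
- by exists y.
(* [t] has at least [M - 1] vertices, so [x :: t] has at least [M >= k]. *)
have := leq_trans (free _ ipt) kM; rewrite -su /= !ltnS leqNgt.
by move: st; rewrite subn0 -su (minn_idPl _) // => ->.
Qed.

(** If the shorter of the lists found in [A] and [B] has length [l], then the size of [S] is at most
    [2 ^ E * l ^ E], while the concatenation has length at least [2 * l]. *)
Lemma transitive_sub E : 0 < E ->
  (forall S, 2 <= #|S| -> exists A B, [/\ A \subset S, B \subset S, complete A B,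
    #|S| <= 2 ^ E * #|A| & #|S| <= 2 ^ E * #|B|]) ->
  forall S, exists s, [/\ pairwise (@arc T) s, {subset s <= S}, #|S| <= size s ^ E &
    minn 2 #|S| <= size s].
Proof.
move=> E0 pair S; have [n] := ubnP #|S|; elim: n S => // n IHn S; rewrite ltnS => Sn.
have [S2|S2] := leqP 2 #|S|; last first.
  have [S0|] := posnP #|S|; first by exists [::]; split; rewrite ?S0 ?minn0.
  rewrite card_gt0 => /set0Pn[x xS]; exists [:: x]; split=> //=.
  - by move=> y; rewrite inE => /eqP ->.
  - by rewrite exp1n -ltnS.
have [A [B [AS BS AB SA SB]]] := pair S S2.
have A0 : 0 < #|A| by move: SA; case: #|A| => //; rewrite muln0; lia.
have B0 : 0 < #|B| by move: SB; case: #|B| => //; rewrite muln0; lia.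
have cAB : #|A| + #|B| <= #|S|.
  have := complete_disjoint AB; rewrite -leq_card_setU => /eqP <-.
  by rewrite subset_leq_card // subUset AS.
have [|sA [pA sAA cA mA]] := IHn A; first by apply: leq_trans Sn; lia.
have [|sB [pB sBB cB mB]] := IHn B; first by apply: leq_trans Sn; lia.
exists (sA ++ sB); split.
- by rewrite pairwise_cat pA pB !andbT; apply/allrelP => x y /sAA xA /sBB; apply: AB.
- by move=> x; rewrite mem_cat => /orP[/sAA/(subsetP AS)|/sBB/(subsetP BS)].
- rewrite size_cat; wlog le : A B sA sB SA SB cA cB
      {AS BS AB A0 B0 cAB pA sAA mA pB sBB mB} / size sA <= size sB.
    move=> hw; have [|/ltnW] := leqP (size sA) (size sB); first exact: (hw A B sA sB).
    by rewrite addnC; apply: (hw B A sB sA).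
  apply: leq_trans SA _; apply: (@leq_trans (2 ^ E * size sA ^ E)).
    by rewrite leq_mul2l cA orbT.
  by rewrite -expnMn leq_exp2r // mul2n -addnn leq_add2l.
- rewrite size_cat; move: mA mB A0 B0; clear.
  move: #|A| #|B| (size sA) (size sB); lia.
Qed.

End Tournament.

(** * Greedy coloring by transitive sets *)

(** Arcs inside [s] increase the index, so no cycle can close up. *)
Lemma pairwise_acyclic (T : tournament) (s : seq T) :
  pairwise (@arc T) s -> acyclic_on [set x in s].
Proof.
move=> ps [//|x p] sub /andP[/= cyc _].
have idx : {in mem s &, subrel (@arc T) (fun u v => index u s < index v s)}.
  move=> u v us vs uv; rewrite ltnNge leq_eqVlt; apply/negP => /orP[/eqP e|lt].
    by move: uv; rewrite -(nth_index u us) -e nth_index // arc_irr.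
  have /(pairwiseP u)/(_ (index v s) (index u s)) := ps.
  rewrite -!topredE /= !index_mem => /(_ vs us lt).
  by rewrite !nth_index // arc_asym.
have xs z : z \in x :: rcons p x -> z \in s.
  rewrite inE mem_rcons => /predU1P[->|zp]; last by have := sub z zp; rewrite inE.
  by have := sub x (mem_head _ _); rewrite inE.
have pa : path (fun u v => index u s < index v s) x (rcons p x).
  by apply: (sub_in_path idx) cyc; apply/allP => z /xs.
have /allP/(_ x) : all (fun v => index x s < index v s) (rcons p x).
  by apply: order_path_min pa => b a c; apply: ltn_trans.
by rewrite mem_rcons mem_head ltnn => /(_ isT).
Qed.

Lemma acyclic_onS (D : digraph) (A B : {set D}) :
  A \subset B -> acyclic_on B -> acyclic_on A.
Proof. by move=> AB aB p pA; apply: aB => x /pA/(subsetP AB). Qed.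

Import Order.TTheory GRing.Theory Num.Theory.
Local Open Scope ring_scope.

Lemma bernoulli_powR (R : realType) (t b : R) : 0 <= t <= 1 -> 0 < b < 1 ->
  (1 - t) `^ b <= 1 - b * t.
Proof.
move=> /andP[t0 t1] /andP[b0 b1].
have := @conjugate_powR R ((1 - t) `^ b) 1 b^-1 (1 - b)^-1 (powR_ge0 _ _) ler01.
rewrite !invr_gt0 !invrK subr_gt0 b0 b1 mulr1 powR1 -powRrM mulfV ?gt_eqF //.
rewrite powRr1 ?subr_ge0 // => /(_ isT isT _) h.
by apply: le_trans (h _) _; [ring|lra].
Qed.

(** One color pays for removing [m] vertices. With [y = n^(1/(2E))], Bernoulli reduces the claim to
    [y <= b * m]; the 2 in the exponent gives [y^2 <= m], leaving room for [b]. *)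
Lemma greedy_step (R : realType) (E n m : nat) : (1 < E)%N ->
  (0 < m <= n)%N -> (n <= m ^ E)%N -> (minn 2 n <= m)%N ->
  1 + (n - m)%:R `^ (1 - (2 * E%:R)^-1) <= n%:R `^ (1 - (2 * E%:R)^-1) :> R.
Proof.
move=> E1 /andP[m0 mn] nmE m2; set e := (2 * E%:R)^-1; set b := 1 - e.
have E2 : 2 <= E%:R :> R by rewrite (ler_nat _ 2).
have e0 : 0 < e by rewrite invr_gt0; lra.
have e4 : e <= 4^-1 by rewrite lef_pV2 ?posrE; lra.
have n0 : (0 : R) < n%:R by rewrite ltr0n (leq_trans m0).
have [n1|n1] := leqP n 1.
  have -> : n = 1%N by lia.
  have -> : (1 - m = 0)%N by lia.
  by rewrite powR0 ?powR1 ?addr0 // /b; lra.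
have {}m2 : 2 <= m%:R :> R by rewrite (ler_nat _ 2); lia.
have m1 : m%:R <= n%:R :> R by rewrite ler_nat.
set y := (n%:R : R) `^ e.
have y0 : 0 < y by apply: powR_gt0.
have yb : n%:R `^ b * y = n%:R :> R.
  by rewrite -powRD ?subrK ?powRr1 ?ltW // gt_eqF ?implybT.
have y2 : y ^+ 2 <= m%:R.
  have -> : y ^+ 2 = n%:R `^ (E%:R^-1).
    rewrite -powR_mulrn ?ltW // -powRrM; congr (_ `^ _); rewrite /e; field; lra.
  have <- : (m%:R ^+ E : R) `^ (E%:R^-1) = m%:R.
    by rewrite -powR_mulrn // -powRrM mulfV ?powRr1 // gt_eqF //; lra.
  apply: ge0_ler_powR; rewrite ?nnegrE ?invr_ge0 ?exprn_ge0 ?ler0n //.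
  by rewrite -natrX ler_nat.
(* [m >= y ^+ 2] suffices when [y] is not close to 1, and [m >= 2] otherwise. *)
have key : y <= b * m%:R.
  have b34 : 3 / 4 <= b by rewrite /b; lra.
  by have [y32|y32] := leP y (3 / 2); nra.
have t01 : 0 <= (m%:R / n%:R : R) <= 1.
  by rewrite ler_pdivrMr // mul1r m1 andbT; apply: divr_ge0.
have b01 : 0 < b < 1 by rewrite /b; lra.
have h := bernoulli_powR t01 b01.
have -> : (n - m)%:R = n%:R * (1 - m%:R / n%:R) :> R.
  by rewrite natrB // mulrBr mulr1 mulrCA mulfV ?gt_eqF // mulr1.
have t1 : m%:R / n%:R <= 1 :> R by case/andP: t01.
rewrite powRM ?ler0n ?subr_ge0 //.
set N := (n%:R `^ b : R) in yb *.
have N0 : 0 < N by apply: powR_gt0.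
have := ler_wpM2l (ltW N0) h; rewrite [leRHS]mulrBr mulr1 => {}h.
suff big : 1 <= N * (b * (m%:R / n%:R)).
  by apply: le_trans (lerD big h) _; rewrite addrC subrK.
have -> : N * (b * (m%:R / n%:R)) = b * m%:R / y.
  by rewrite -yb; field; rewrite !gt_eqF.
by rewrite ler_pdivlMr // mul1r.
Qed.

(** Colors are natural numbers and [f] is total, so the fresh color [N] extends a coloring of the
    rest without changing types. *)
Lemma greedy_coloring (R : realType) (T : tournament) (E : nat) : (1 < E)%N ->
  (forall S : {set T}, exists s : seq T, [/\ pairwise (@arc T) s, {subset s <= S},
     (#|S| <= size s ^ E)%N & (minn 2 #|S| <= size s)%N]) ->
  forall S : {set T}, exists N (f : T -> nat),
    [/\ N%:R <= #|S|%:R `^ (1 - (2 * E%:R)^-1) :> R, {in S, forall x, (f x < N)%N} &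
        forall i, acyclic_on [set x in S | f x == i]].
Proof.
move=> E1 trans S; have [n] := ubnP #|S|; elim: n S => // n IHn S; rewrite ltnS => Sn.
have [->|S0] := eqVneq S set0.
  exists 0%N, (fun=> 0%N); split; first exact: powR_ge0.
    by move=> x; rewrite inE.
  move=> i [//|x p] /(_ x (mem_head _ _)).
  by rewrite !inE.
have [s [ps sS cs ms]] := trans S.
have us : uniq s by apply: pairwise_uniq ps; apply: arc_irr.
set I := [set x in s].
have cI : #|I| = size s by rewrite cardsE; apply/card_uniqP.
have IS : I \subset S by apply/subsetP => x; rewrite inE => /sS.
have Sp : (0 < #|S|)%N by rewrite card_gt0.
have s0 : (0 < size s <= #|S|)%N.
  rewrite -{2}cI subset_leq_card // andbT; apply: leq_trans ms.
  by rewrite leq_min Sp.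
have cD : #|S :\: I| = (#|S| - size s)%N by rewrite cardsD (setIidPr IS) cI.
have [|N [f [Nle fN fa]]] := IHn (S :\: I).
  by rewrite cD; apply: leq_trans Sn; case/andP: s0 => s0 _; rewrite ltn_subrL s0.
exists N.+1, (fun x => if x \in I then N else f x); split.
- apply: le_trans (greedy_step R E1 s0 cs ms).
  by rewrite -natr1 addrC lerD2l -cD.
- move=> x xS; case: ifPn => // xI; apply: ltnW; rewrite ltnS; apply: fN.
  by rewrite inE xI.
move=> i; have [->|iN] := eqVneq i N.
  apply: acyclic_onS (pairwise_acyclic ps); apply/subsetP => x.
  rewrite inE => /andP[xS]; case: ifPn => // xI.
  by have := fN x; rewrite inE xI => /(_ xS); rewrite ltn_neqAle => /andP[/negbTE->].
apply: acyclic_onS (fa i); apply/subsetP => x.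
rewrite !inE => /andP[xS]; case: (x \in s) => /=; last by rewrite xS.
by rewrite eq_sym (negbTE iN).
Qed.

Lemma dichromatic_number_le (D : digraph) (N : nat) (f : D -> nat) :
  (forall x, (f x < N)%N) -> (forall i, acyclic_on [set x | f x == i]) ->
  (dichromatic_number D <= N)%N.
Proof.
move=> fN fa; rewrite /dichromatic_number; case: ex_minnP => m _; apply.
apply/asboolP; exists [ffun x => Ordinal (fN x)] => i.
apply: acyclic_onS (fa i); apply/subsetP => x.
by rewrite !inE ffunE -val_eqE.
Qed.

(** * Assembling the constants *)

Theorem theorem3p3 (R : realType) :
  exists c : R, 0 < c /\
    forall (k : nat) (T : tournament),
      (2 <= k)%N -> (1 <= #|T|)%N -> dipath_free k T ->
      (dichromatic_number T)%:R <=
        #|T|%:R `^ (1 - c / (k%:R * log2 (k%:R : R) ^+ 2)).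
Proof.
(* The exponent saved is [1 / (2E)] with [E = 11 k h^2] and [h <= 2 log k], so
   [2E <= 88 k (log k)^2]. *)
exists (88^-1); split; first by lra.
move=> k T k2 T1 nocopy.
pose h := up_log 2 k; pose E := (11 * k * h ^ 2)%N.
have h0 : (0 < h)%N by rewrite up_log_gt0.
have E1 : (1 < E)%N by rewrite /E; have : (0 < h ^ 2)%N by [rewrite expn_gt0 h0]; nia.
have free (s : seq T) : ipath s -> (size s < k)%N.
  by move=> ips; rewrite ltnNge; apply/negP => ks; exact: nocopy (ipath_copy ips ks).
have hk : (1 < k <= 2 ^ h)%N by rewrite k2 up_logP.
(* In exponents: [5 + 2h + 4kh + 3kh^2 <= 11kh^2], as [k >= 2] and [h >= 1]. *)
have bE : (32 * (4 * (16 * (2 ^ h) ^ 3) ^ k) ^ h <= 2 ^ E)%N.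
  have -> : (32 * (4 * (16 * (2 ^ h) ^ 3) ^ k) ^ h
      = 2 ^ (5 + (2 + (4 + h * 3) * k) * h))%N.
    by rewrite expnD expnM expnD expnM expnD expnM.
  rewrite leq_exp2l // /E -mulnn; clear -h0 k2; nia.
have := transitive_sub (ltnW E1) (pure_pair hk free bE).
case/(greedy_coloring R E1)/(_ setT) => N [f [Nle fN fa]].
have /dichromatic_number_le-/(_ (fun i => acyclic_onS _ (fa i))) le x :
  (f x < N)%N by apply: fN.
apply: (@le_trans _ _ N%:R).
  by rewrite ler_nat le // => i; apply/subsetP => x; rewrite !inE.
apply: le_trans Nle _; rewrite cardsT; apply: ler_powR; first by rewrite (ler_nat _ 1).
rewrite lerD2l lerN2; set L := log2 _.
have ln2 : 0 < ln (2 : R) by rewrite ln_gt0 // ltr1n.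
have k0 : (0 : R) < k%:R by rewrite ltr0n; lia.
have L1 : 1 <= L.
  by rewrite /L /log2 ler_pdivlMr // mul1r ler_ln ?posrE // (ler_nat _ 2).
(* Rounding up gives [h - 1 <= L]; with [1 <= L] this becomes [h <= 2L]. *)
have hL : h.-1%:R <= L.
  rewrite /L /log2 ler_pdivlMr // mulr_natl -lnXn // ler_ln ?posrE ?exprn_gt0 //.
  by rewrite -natrX ler_nat ltnW // up_log_gtn.
have {}hL : h%:R <= 2 * L by move: hL; rewrite -{2}(prednK h0) -natr1; lra.
have h1 : 0 < h%:R :> R by rewrite ltr0n.
have hL2 : h%:R ^+ 2 <= 4 * L ^+ 2 by nra.
have L0 : 0 < L by apply: lt_le_trans L1.
have EE : E%:R = 11 * k%:R * h%:R ^+ 2 :> R by rewrite /E natrM natrX natrM.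
have E0 : 0 < 2 * E%:R :> R by rewrite EE !mulr_gt0 ?exprn_gt0.
have kL0 : 0 < 88 * (k%:R * L ^+ 2)
  by apply: mulr_gt0; rewrite ?ltr0n //; apply: mulr_gt0 => //; apply: exprn_gt0.
rewrite -invfM lef_pV2 ?posrE // EE.
by have := ler_wpM2l (ltW k0) hL2; lra.
Qed.
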